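(* Let $P\in\mathbb{R}[x_1,\ldots,x_n]$ be a polynomial of degree $m$, and let $f:\{1,\ldots,n\}\to\mathbb{N}^+$ satisfy $\sum_{i=1}^n f(i)=m+n$. Let $$NZ(P)=\{(z_1,\ldots,z_n)\in\{0,\ldots,f(1)-1\}\times\cdots\times\{0,\ldots,f(n)-1\}:P(z_1,\ldots,z_n)\neq0\}.$$ If $$\sum_{(z_1,\ldots,z_n)\in NZ(P)}(-1)^{\sum_{i=1}^n z_i}\prod_{i=1}^n\binom{f(i)-1}{z_i}P(z_1,\ldots,z_n)\neq0,$$ then for all sets $S_1,\ldots,S_n\subseteq\mathbb{R}$ with $|S_i|\ge f(i)$ for every $i$, there exists $(s_1,\ldots,s_n)\in S_1\times\cdots\times S_n$ with $P(s_1,\ldots,s_n)\neq0$. *)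

(* Defs.v *)
From HB Require Import structures.
From mathcomp Require Import all_boot all_order all_algebra.
From mathcomp Require Import boolp classical_sets cardinality reals.
From mathcomp Require Import mpoly.
Set Implicit Arguments.
Unset Strict Implicit.
Unset Printing Implicit Defensive.
Import GRing.Theory.
Local Open Scope ring_scope.

(* The product of the intervals {0, ..., f i - 1}; 'dffun' carries the finType
   structure for codomains depending on i. *)
Definition box (n : nat) (f : 'I_n -> nat) : finType :=
  {dffun forall i : 'I_n, 'I_(f i)}.

Definition natpt (R : realType) (n : nat) (f : 'I_n -> nat) (z : box f) :
    'I_n -> R :=
  fun i => (z i : nat)%:R.

Definition NZ (R : realType) (n : nat) (P : {mpoly R[n]}) (f : 'I_n -> nat) :
    {set box f} :=
  [set z : box f | P.@[natpt R z] != 0].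

(* Main.v *)
(* For each i choose points a_i(j) and weights w_i(j), j < f(i), with
   sum_j w_i(j) a_i(j)^k = 0 for all k < d_i := f(i) - 1.  Since deg P = sum_i d_i,
   the weighted sum of P over the grid only sees the monomial x^d: any other
   monomial of P has some exponent smaller than d_i.  Hence the sum is
   [x^d]P * prod_i sum_j w_i(j) a_i(j)^(d_i).  The points 0, ..., d_i with signed
   binomial weights show that [x^d]P is nonzero; f(i) distinct points of S_i,
   with weights taken from the inverse Vandermonde matrix, then show that P cannot
   vanish on the whole grid. *)
Require Import Defs.
From HB Require Import structures.
From mathcomp Require Import all_boot all_order all_algebra.
From mathcomp Require Import boolp classical_sets cardinality reals.
From mathcomp Require Import mpoly.
From mathcomp Require Import functions.
Set Implicit Arguments.
Unset Strict Implicit.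
Unset Printing Implicit Defensive.
Import GRing.Theory.
Local Open Scope ring_scope.

(** Each [T i] is viewed as the fibre over [i] of one tagged sum type, which reduces the dependent
    case to ordinary distributivity; [fprod] is the bridge. *)
Lemma bigA_distr_dffun (A : comNzRingType) (I : finType) (T : I -> finType)
    (F : forall i, T i -> A) :
  \prod_i \sum_(j : T i) F i j =
  \sum_(z : {dffun forall i, T i}) \prod_i F i (z i).
Proof.
rewrite (reindex (@dffun_of_fprod I T)); last exact/onW_bij/dffun_of_fprod_bij.
pose G i := [ffun j => F i j].
transitivity (\sum_(t : fprod T) \prod_i G i (t i)).
  rewrite big_fprod.
  transitivity (\prod_i \sum_(j in tagged_with T i) untag 0 (G i) j); last first.
    exact: (bigA_distr_big_dep (fun i => mem (tagged_with T i))).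
  apply: eq_bigr => i _; rewrite -(big_tag (fun i j => G i j)).
  by apply: eq_bigr => j _; rewrite ffunE.
by apply: eq_bigr => t _; apply: eq_bigr => i _; rewrite !ffunE.
Qed.

(** Otherwise [d <= e] pointwise, and the degree bound makes the two sums equal, hence all exponents
    equal. *)
Lemma mdeg_le_exists_lt (n : nat) (d e : 'X_{1..n}) :
  (mdeg e <= mdeg d)%N -> e != d -> exists i, (e i < d i)%N.
Proof.
move=> le_ed /eqP neq_ed; apply: contrapT => /forallNP ge_ed; apply: neq_ed.
have le_de i : (d i <= e i)%N by rewrite leqNgt; exact/negP/ge_ed.
have eq_sum : (\sum_i d i == \sum_i e i)%N.
  by rewrite eqn_leq leq_sum//= -!mdegE.
apply/mnmP => i; apply/esym/eqP.
by move: eq_sum; rewrite (leqif_sum (fun i _ => leqif_eq (le_de i))) =>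
  /forallP/(_ i).
Qed.

Lemma weighted_sum_meval (A : comNzRingType) (n : nat) (P : {mpoly A[n]})
    (d : 'X_{1..n}) (f : 'I_n -> nat) (w a : forall i, 'I_(f i) -> A) :
  (msize P <= (mdeg d).+1)%N ->
  (forall i k, (k < d i)%N -> \sum_j w i j * a i j ^+ k = 0) ->
  \sum_(z : box f) (\prod_i w i (z i)) * P.@[fun i => a i (z i)] =
  P@_d * \prod_i \sum_j w i j * a i j ^+ d i.
Proof.
move=> sizeP w0.
(* Over a product grid, the weighted sum of each monomial factors into one-variable moments. *)
transitivity (\sum_(e <- msupp P) P@_e * \prod_i \sum_j w i j * a i j ^+ e i).
  under eq_bigr do rewrite mevalE mulr_sumr.
  rewrite exchange_big; apply: eq_bigr => e _ /=.
  rewrite bigA_distr_dffun mulr_sumr; apply: eq_bigr => z _.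
  by rewrite big_split/= mulrCA.
have e0 e : e \in msupp P -> e != d ->
    P@_e * \prod_i \sum_j w i j * a i j ^+ e i = 0.
  move=> /msize_mdeg_lt /leq_trans /(_ sizeP) le_ed /(mdeg_le_exists_lt le_ed).
  by move=> [i lt_ed]; rewrite (bigD1 i)//= w0// mul0r mulr0.
(* Outside the support [P@_d] is 0, so both sides vanish. *)
have [dP|dP] := boolP (d \in msupp P); last first.
  rewrite (memN_msupp_eq0 dP) mul0r big_seq big1// => e eP.
  by rewrite e0//; apply: contraNneq dP => <-.
rewrite (bigD1_seq d)//= ?msupp_uniq// [X in _ + X]big_seq_cond.
by rewrite [X in _ + X]big1 ?addr0// => e /andP[]; exact: e0.
Qed.

(** Up to sign this is the [d]-th finite difference at 0 of a power below [d]. *)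
Lemma sum_signed_binomial_pow (A : comNzRingType) (d k : nat) : (k < d)%N ->
  \sum_(j < d.+1) (-1) ^+ j * 'C(d, j)%:R * (j : nat)%:R ^+ k = 0 :> A.
Proof.
elim: d k => // d IHd [|k].
  move=> _; transitivity ((1 - 1) ^+ d.+1 : A); last by rewrite subrr expr0n.
  by rewrite exprBn; apply: eq_bigr => j _; rewrite !expr1n expr0 !mulr1 mulr_natr.
rewrite ltnS => lt_kd; rewrite big_ord_recl/= expr0n mulr0 add0r.
(* The term at 0 is gone. After the shift to [j.+1], absorption of one factor [j.+1] turns
   ['C(d.+1, j.+1)] into ['C(d, j)], and expanding [j.+1 ^+ k] leaves powers [l <= k < d] for the
   induction. *)
transitivity (- d.+1%:R * \sum_(l < k.+1)
   'C(k, l)%:R * \sum_(j < d.+1) (-1) ^+ j * 'C(d, j)%:R * (j : nat)%:R ^+ l : A).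
  under [in RHS]eq_bigr do rewrite mulr_sumr.
  rewrite exchange_big mulr_sumr; apply: eq_bigr => j _ /=.
  have binS : 'C(d.+1, j.+1)%:R * j.+1%:R = d.+1%:R * 'C(d, j)%:R :> A.
    by rewrite -!natrM mulnC mul_bin_diag.
  have powS : j.+1%:R ^+ k = \sum_(l < k.+1) 'C(k, l)%:R * (j : nat)%:R ^+ l :> A.
    rewrite -natr1 addrC exprDn; apply: eq_bigr => l _.
    by rewrite expr1n mul1r mulr_natl.
  under eq_bigr do rewrite mulrCA.
  rewrite -mulr_sumr -powS /bump/= add1n [_%:R ^+ k.+1]exprS exprS mulN1r !mulNr.
  by congr (- _); rewrite -!mulrA ['C(_, _)%:R * (_ * _)]mulrA binS -!mulrA mulrCA.
rewrite big1 ?mulr0// => l _; rewrite IHd ?mulr0//.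
by rewrite (leq_ltn_trans _ lt_kd)// -ltnS.
Qed.

Lemma exists_top_weights (F : fieldType) (d : nat) (a : 'I_d.+1 -> F) :
  injective a ->
  exists w : 'I_d.+1 -> F,
    (forall k, (k < d)%N -> \sum_j w j * a j ^+ k = 0) /\
    \sum_j w j * a j ^+ d = 1.
Proof.
move=> inj_a; pose V := Vandermonde d.+1 (\row_j a j).
have unitV : V \in unitmx.
  rewrite unitmxE det_Vandermonde unitfE; apply/prodf_neq0 => i _.
  apply/prodf_neq0 => j lt_ij; rewrite !mxE subr_eq0 (inj_eq inj_a).
  by rewrite neq_ltn lt_ij orbT.
(* Row [k] of [V] holds the [k]-th powers, so pairing it with the last column of the inverse gives
   an entry of the identity matrix. *)
pose w j := invmx V j ord_max.
have wV (k : 'I_d.+1) : \sum_j w j * a j ^+ k = (k == ord_max)%:R.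
  have /matrixP/(_ k ord_max) := mulmxV unitV; rewrite !mxE => <-.
  by apply: eq_bigr => j _; rewrite !mxE mulrC.
exists w; split=> [k lt_kd|]; last by rewrite (wV ord_max) eqxx.
by rewrite (wV (Ordinal (ltnW lt_kd : (k < d.+1)%N))) -val_eqE/= ltn_eqF.
Qed.

(** With top moments normalised to 1, the weighted sum of [P] over the grid is exactly [P@_d], so it
    cannot have only zero terms. *)
Lemma combinatorial_nullstellensatz (F : fieldType) (n : nat) (P : {mpoly F[n]})
    (d : 'X_{1..n}) (a : forall i, 'I_(d i).+1 -> F) :
  (msize P <= (mdeg d).+1)%N -> P@_d != 0 -> (forall i, injective (a i)) ->
  exists z : box (fun i => (d i).+1), P.@[fun i => a i (z i)] != 0.
Proof.
move=> sizeP Pd0 inj_a.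
have /all_sig[w wP] : forall i, {w : 'I_(d i).+1 -> F |
    (forall k, (k < d i)%N -> \sum_j w j * a i j ^+ k = 0) /\
    \sum_j w j * a i j ^+ d i = 1}.
  by move=> i; exact/cid/exists_top_weights.
apply: contrapT => /forallNP P0.
move: Pd0; apply/negP; rewrite negbK.
have w0 i k : (k < d i)%N -> \sum_j w i j * a i j ^+ k = 0.
  by case: (wP i) => + _; exact.
have := weighted_sum_meval sizeP w0.
rewrite big1; last by move=> z _; move/negP/negbNE/eqP: (P0 z) => ->; rewrite mulr0.
by rewrite big1 ?mulr1 => [<-//|i _]; case: (wP i).
Qed.

Lemma card_ord_le_injective (T : Type) (k : nat) (A : set T) :
  (`I_k #<= A)%card ->
  exists2 a : 'I_k -> T, forall j, A (a j) & injective a.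
Proof.
move=> /card_leP[h].
pose u (j : 'I_k) : `I_k :=
  exist _ (j : nat) (mem_set (ltn_ord j : `I_k j)).
exists (fun j => val (h (u j))) => [j|j l /val_inj]; first exact: set_valP.
by move=> /(@inj _ _ _ h _ _ (mem_set I) (mem_set I)) [] /val_inj.
Qed.

Theorem theorem2p1 (R : realType) (n m : nat) (P : {mpoly R[n]})
    (f : 'I_n -> nat) :
  msize P = m.+1 ->
  (forall i : 'I_n, (0 < f i)%N) ->
  (\sum_(i < n) f i = m + n)%N ->
  \sum_(z in NZ P f)
     (-1) ^+ (\sum_(i < n) z i)%N *
     (\prod_(i < n) 'C(f i - 1, z i)%:R) * P.@[natpt R z] != 0 ->
  forall S : 'I_n -> set R,
    (forall i : 'I_n, (`I_(f i) #<= S i)%card) ->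
    exists s : 'I_n -> R, (forall i : 'I_n, S i (s i)) /\ P.@[s] != 0.
Proof.
move=> sizeP f_gt0 sumf sum_neq0 S leS.
pose d : 'X_{1..n} := [multinom (f i).-1 | i < n].
have fE : f = fun i => (d i).+1 by apply/funext => i; rewrite mnmE prednK.
have mdegd : mdeg d = m.
  apply: (@addIn n); rewrite -sumf fE mdegE.
  under [RHS]eq_bigr do rewrite -addn1.
  by rewrite big_split/= sum_nat_const card_ord muln1.
(* Once [d] is opaque, [f] can be replaced everywhere by [(d i).+1], also inside the types of the
   grid. *)
clearbody d; subst f.
have sizePd : (msize P <= (mdeg d).+1)%N by rewrite mdegd sizeP.
have Pd0 : P@_d != 0.
  apply: contraNneq sum_neq0 => Pd0.
  pose w i (j : 'I_(d i).+1) : R := (-1) ^+ j * 'C(d i, j)%:R.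
  pose a i (j : 'I_(d i).+1) : R := (j : nat)%:R.
  have := @weighted_sum_meval _ _ P d _ w a sizePd
    (fun i k => @sum_signed_binomial_pow R (d i) k).
  rewrite Pd0 mul0r => sum0; apply/eqP; rewrite -[RHS]sum0.
  (* The hypothesis sums over [NZ] only; the other points of the box add nothing, as [P] vanishes
     there. *)
  rewrite [RHS](bigID (mem (NZ P _)))/=.
  rewrite [X in _ = _ + X]big1 ?addr0 => [|z]; last first.
    by rewrite inE negbK => /eqP Pz; rewrite [_.@[_]]Pz mulr0.
  apply: eq_bigr => z _; congr (_ * _); rewrite /w big_split/= -expr_sum.
  by congr (_ * _); apply: eq_bigr => i _; rewrite subn1.
have /all_sig2[a aS inj_a] : forall i,
    {a : 'I_(d i).+1 -> R | forall j, S i (a j) & injective a}.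
  by move=> i; exact/cid2/card_ord_le_injective.
have [z Pz] := combinatorial_nullstellensatz sizePd Pd0 inj_a.
by exists (fun i => a i (z i)).
Qed.
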